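(* Let $n\ge 2$ be even and let $M_1$ and $M_2$ be $n$-dimensional pseudomanifolds, with every facet having weight $1$. Then there exists a connected sum $M_1\#M_2$ (i.e. a choice of bricks and gluing map) such that $$\operatorname{tr}(M_1\#M_2)=\max(\operatorname{tr}(M_1),\operatorname{tr}(M_2)).$$
   Context: An $n$-dimensional pseudomanifold is a finite $n$-dimensional simplicial complex such that: it is the union of its $n$-simplices; each $(n-1)$-dimensional face is incident to exactly two $n$-simplices; and the graph with a vertex for each $n$-simplex and an edge joining two vertices exactly when the corresponding simplices share an $(n-1)$-face is connected. The $n$-simplices are called bricks and the $(n-1)$-faces are called facets; each facet is given weight $1$. Connected sum: given distinct $n$-dimensional pseudomanifolds $M_1,M_2$, choose an $n$-simplex $C_i\subset M_i$ for $i=1,2$; $M_1\#M_2$ is the result of removing (the interior of) $C_i$ from $M_i$ and gluing the resulting complexes via some simplicial homeomorphism $\partial C_1\to\partial C_2$. The result depends on the choices of $C_1$, $C_2$ and the gluing map. Trunk: let $M$ have $N$ bricks. An ordering $\mathcal{O}$ is a bijection from the set of bricks to $\{1,\dots,N\}$. For $j\in\{0,1,\dots,N\}$, $\Lambda(j)$ is the number of facets shared by a brick $T$ with $\mathcal{O}(T)\le j$ and a brick $T'$ with $\mathcal{O}(T')>j$. The trunk $\operatorname{tr}(\mathcal{O})$ of $\mathcal{O}$ is the maximum value achieved by $\Lambda$. The trunk $\operatorname{tr}(M)$ is the minimum of $\operatorname{tr}(\mathcal{O})$ over all orderings $\mathcal{O}$ of $M$. *)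

(* Defs.v *)
From mathcomp Require Import all_boot.

Set Implicit Arguments.
Unset Strict Implicit.
Unset Printing Implicit Defensive.

(* A finite simplicial complex is given by its set of nonempty faces, each face
   being its set of vertices; an n-simplex is a face with n.+1 vertices.
   Points of V lying in no face are not vertices of the complex. *)
Section Complexes.

Variables (V : finType) (n : nat).
Implicit Types (K : {set {set V}}) (s t f T C : {set V}).

Definition simplicial_complex K : Prop :=
  set0 \notin K /\
  forall s t, s \in K -> t \subset s -> t != set0 -> t \in K.

Definition has_dim K : Prop := \max_(s in K) #|s| = n.+1.

Definition bricks K : {set {set V}} := [set s in K | #|s| == n.+1].

Definition facets K : {set {set V}} := [set s in K | #|s| == n].

Definition brick_adj K : rel {set V} := fun T T' =>
  [&& T \in bricks K, T' \in bricks K, T != T' &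
      [exists f in facets K, (f \subset T) && (f \subset T')]].

Definition pseudomanifold K : Prop :=
  [/\ simplicial_complex K,
      has_dim K,
      forall s, s \in K -> exists2 T, T \in bricks K & s \subset T,
      forall f, f \in facets K -> #|[set T in bricks K | f \subset T]| = 2 &
      {in bricks K &, forall T T', connect (brick_adj K) T T'}].

(* The boundary complex of the simplex with vertex set C. *)
Definition boundary C : {set {set V}} := [set s | (s != set0) && (s \proper C)].

(* With N = #|bricks K|, the type 'I_N.+1 is {0, ..., N}.  Only the values of O
   on bricks matter; there O is a bijection onto {1, ..., N}. *)
Definition is_ordering K (O : {ffun {set V} -> 'I_(#|bricks K|).+1}) : bool :=
  dinjectiveb O (bricks K) &&
  (O @: bricks K == [set i : 'I_(#|bricks K|).+1 | 0 < i]).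

Definition Lambda K (O : {ffun {set V} -> 'I_(#|bricks K|).+1})
    (j : 'I_(#|bricks K|).+1) : nat :=
  #|[set f in facets K |
      [exists T in bricks K, [exists T' in bricks K,
        [&& O T <= j, j < O T', f \subset T & f \subset T']]]]|.

Definition ordering_trunk K (O : {ffun {set V} -> 'I_(#|bricks K|).+1}) : nat :=
  \max_(j < (#|bricks K|).+1) Lambda O j.

Lemma ordering_trunk_ex K :
  exists k, [exists O : {ffun {set V} -> 'I_(#|bricks K|).+1},
               is_ordering O && (ordering_trunk O == k)].
Proof.
pose O := [ffun T : {set V} =>
             inord (index T (enum (bricks K))).+1 : 'I_(#|bricks K|).+1].
exists (ordering_trunk O); apply/existsP; exists O; rewrite eqxx andbT.
have OE T : T \in bricks K -> O T = (index T (enum (bricks K))).+1 :> nat.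
  by move=> TK; rewrite ffunE inordK // ltnS cardE index_mem mem_enum.
have Oinj : {in bricks K &, injective O}.
  move=> T T' TK TK' /(congr1 val) /=; rewrite !OE // => -[].
  by move/(index_inj T); apply; rewrite mem_enum.
apply/andP; split; first exact/dinjectiveP.
rewrite eqEcard; apply/andP; split.
  by apply/subsetP=> _ /imsetP[T TK ->]; rewrite inE OE.
rewrite card_in_imset //;
suff -> : [set i : 'I_(#|bricks K|).+1 | 0 < i] = [set~ ord0].
  by rewrite cardsC1 card_ord.
by apply/setP=> i; rewrite !inE lt0n.
Qed.

Definition trunk K : nat := ex_minn (ordering_trunk_ex K).

End Complexes.

Section ConnectedSum.

Variables V1 V2 : finType.

(* Only the values of phi on the vertices of K matter. *)
Definition simplicial_iso (K : {set {set V1}}) (L : {set {set V2}})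
    (phi : V1 -> V2) : Prop :=
  {in cover K &, injective phi} /\ [set phi @: s | s : {set V1} in K] = L.

Definition gluing (n : nat) (M1 : {set {set V1}}) (M2 : {set {set V2}})
    (C1 : {set V1}) (C2 : {set V2}) (phi : V1 -> V2) : Prop :=
  [/\ C1 \in bricks n M1, C2 \in bricks n M2 &
      simplicial_iso (boundary C1) (boundary C2) phi].

(* The disjoint union V1 + V2 with each v in C1 identified with phi v is
   represented inside V1 + V2 by choosing inr (phi v) for the class of v. *)
Definition glue1 (C1 : {set V1}) (phi : V1 -> V2) (v : V1) : V1 + V2 :=
  if v \in C1 then inr (phi v) else inl v.

Definition connected_sum (M1 : {set {set V1}}) (M2 : {set {set V2}})
    (C1 : {set V1}) (C2 : {set V2}) (phi : V1 -> V2) : {set {set V1 + V2}} :=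
  [set glue1 C1 phi @: s | s : {set V1} in M1 :\ C1] :|:
  [set inr @: s | s : {set V2} in M2 :\ C2].

End ConnectedSum.

(* Main.v *)
Require Import Defs.
From mathcomp Require Import all_boot zify.

Set Implicit Arguments.
Unset Strict Implicit.
Unset Printing Implicit Defensive.

(** Let C1 be the last brick of an optimal ordering of M1 and C2 the first brick
of an optimal ordering of M2.  Listing the bricks of M1 other than C1 and then
those of M2 other than C2 orders the connected sum, for any gluing map.  A
prefix of this order that stays inside M1 cuts exactly the facets that it cuts
in M1, because a facet of C1 reaches the complement of the prefix whether its
second brick is C1 or a brick of M2; when the prefix contains all of M1 the same
holds on the side of M2.  So the trunk of the sum is at most the maximum
([trunk_glued_le]).

Conversely, an ordering of the sum induces one of M1: keep the bricks of M1 in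
place and put C1 in the place of the first brick of M2.  The M1-cut of a prefix
met before that place is again the cut in the sum.  After that place, C1 belongs
to the prefix while only some bricks of M2 may do so; this costs nothing,
because the dual graph of a pseudomanifold is (n+1)-edge-connected ([cut_ge]): a
nonempty set B of bricks of M2 that avoids C2 cuts at least n+1 facets, hence
cuts at least as many facets off C2 as there are facets of C2 that it does not
reach ([cut_glued_both_sides]).  This gives the lower bound
([trunk_glued_ge]), and the situation is symmetric in M1 and M2.

Edge-connectivity holds because the facets cut by a set of bricks form the mod 2
boundary of that set, so every (n-2)-face lies in an even number of them
([cut_cycle]); a nonempty cut containing a facet f0 then contains a further
facet through each of the n codimension-one faces of f0. *)

(** * Cuts and the trunk *)

Lemma odd_sum (I : finType) (P : pred I) (F : I -> nat) :
  odd (\sum_(i | P i) F i) = odd #|[set i | P i & odd (F i)]|.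
Proof.
rewrite -sum1_card.
rewrite !(big_morph odd oddD (erefl : odd 0 = false)).
rewrite big_mkcond [RHS]big_mkcond; apply: eq_bigr => i _.
by rewrite inE; case: (P i); case: (odd _).
Qed.

Section Cuts.

Variables (V : finType) (n : nat).
Implicit Types (K : {set {set V}}) (f r T C : {set V}) (A : {set {set V}}).

Definition cut K A : {set {set V}} :=
  [set f in facets n K |
    [exists T in bricks n K, [exists T' in bricks n K,
      [&& T \in A, T' \notin A, f \subset T & f \subset T']]]].

Lemma cutP K A f :
  reflect (f \in facets n K /\ exists T T',
             [/\ T \in bricks n K, T' \in bricks n K, T \in A, T' \notin A
               & f \subset T /\ f \subset T'])
          (f \in cut K A).
Proof.
apply: (iffP idP) => [|[fK]].
  rewrite inE => /andP[fK] /exists_inP[T TK].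
  case/exists_inP=> T' TK' /and4P[TA TA' fT fT'].
  by split=> //; exists T, T'.
case=> T [T' [TK TK' TA TA' [fT fT']]]; rewrite inE fK /=.
apply/exists_inP; exists T => //; apply/exists_inP; exists T' => //.
exact/and4P.
Qed.

Lemma cutC K A : cut K (~: A) = cut K A.
Proof.
apply/setP=> f; apply/cutP/cutP=> -[fK [T [T' []]]]; rewrite ?in_setC.
  move=> TK TK' TA; rewrite negbK => TA' [fT fT'].
  by split=> //; exists T', T.
move=> TK TK' TA TA' [fT fT']; split=> //; exists T', T.
by rewrite !in_setC TA; split.
Qed.

(** Orderings are replaced by arbitrary injective heights on the bricks: heights
can be transported along gluings, shifted and patched without renumbering. *)
Lemma trunk_leP K k :
  reflect (exists h : {set V} -> nat, {in bricks n K &, injective h} /\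
             forall t, #|cut K [set T | h T < t]| <= k)
          (trunk n K <= k).
Proof.
apply: (iffP idP).
  rewrite /trunk; case: ex_minnP => m /existsP[O /andP[/andP[]]].
  move=> /dinjectiveP Oinj /eqP Oim /eqP Om _ mk.
  exists (fun T => O T : nat); split.
    by move=> T T' TK TK' /val_inj; apply: Oinj.
  move=> t; apply: leq_trans mk; rewrite -Om.
  (* Positions are at most the number of bricks, and those less than t are those
     at most [t.-1]. *)
  have ltN : minn t.-1 #|bricks n K| < #|bricks n K|.+1.
    by rewrite ltnS geq_minr.
  pose j : 'I_(#|bricks n K|).+1 := Ordinal ltN.
  apply: leq_trans (leq_bigmax_cond (F := Lambda O) j isT).
  apply: subset_leq_card; apply/subsetP=> f /cutP.
  case=> fK [T [T' [TK TK' TA TA' [fT fT']]]].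
  move: TA TA'; rewrite !inE => TA TA'.
  move: fK; rewrite inE => -> /=.
  apply/exists_inP; exists T => //; apply/exists_inP; exists T' => //.
  apply/and4P; split=> //=.
    rewrite leq_min -ltnS (ltn_predK TA) TA /=; exact: ltn_ord (O T).
  by rewrite gtn_min (leq_trans _ (_ : t <= O T')) ?(ltn_predK TA) // leqNgt.
case=> h [hinj hk]; set N := #|bricks n K|.
rewrite /trunk; case: ex_minnP => m _ minm.
(* Heights are turned into positions by ranking the bricks. *)
pose rk T := #|[set S in bricks n K | h S <= h T]|.
have rkN T : rk T < N.+1.
  by rewrite ltnS; apply/subset_leq_card/subsetP=> S; rewrite inE => /andP[].
have rkm T T' : h T <= h T' -> rk T <= rk T'.
  move=> le; apply/subset_leq_card/subsetP=> S; rewrite !inE => /andP[-> /=].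
  by move/leq_trans; apply.
have rkl T T' : T' \in bricks n K -> h T < h T' -> rk T < rk T'.
  move=> TK lt; apply: proper_card; apply/properP; split.
    apply/subsetP=> S; rewrite !inE => /andP[-> /=] le.
    exact: leq_trans le (ltnW lt).
  by exists T'; rewrite inE TK //= -ltnNge.
pose O : {ffun {set V} -> 'I_N.+1} := [ffun T => Ordinal (rkN T)].
have Oinj : {in bricks n K &, injective O}.
  move=> T T' TK TK'; rewrite !ffunE => -[eqr]; apply: hinj => //.
  by case: (ltngtP (h T) (h T')) => // /rkl; [move/(_ TK')|move/(_ TK)];
    rewrite eqr ltnn.
have Oord : is_ordering O.
  apply/andP; split; first exact/dinjectiveP.
  rewrite eqEcard; apply/andP; split.
    apply/subsetP=> _ /imsetP[T TK ->]; rewrite inE ffunE /=.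
    by apply/card_gt0P; exists T; rewrite inE TK /=.
  rewrite card_in_imset //.
  suff -> : [set i : 'I_N.+1 | 0 < i] = [set~ ord0].
    by rewrite cardsC1 card_ord.
  by apply/setP=> i; rewrite !inE lt0n.
apply: leq_trans (minm (ordering_trunk O) _) _.
  by apply/existsP; exists O; rewrite Oord eqxx.
apply/bigmax_leqP=> j _.
(* The first j bricks are those below the threshold t. *)
pose t := \max_(T in bricks n K | rk T <= j) (h T).+1.
apply: leq_trans (hk t); apply: subset_leq_card; apply/subsetP=> f.
rewrite inE => /andP[fK /exists_inP[T TK /exists_inP[T' TK' /and4P[]]]].
rewrite !ffunE /= => lT lT' fT fT'; apply/cutP; split=> //.
exists T, T'; split=> //; rewrite inE.
  by apply: (leq_bigmax_cond (F := fun S => (h S).+1)); rewrite TK.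
rewrite -leqNgt; apply/bigmax_leqP=> S /andP[SK lS].
rewrite ltnNge; apply/negP=> /rkm le.
by move: (leq_trans lT' (leq_trans le lS)); rewrite ltnn.
Qed.

End Cuts.

(** * Edge-connectivity of the dual graph *)

Section Pseudomanifold.

Variables (V : finType) (n : nat) (K : {set {set V}}).
Hypotheses (n_gt0 : 0 < n) (pK : pseudomanifold n K).
Implicit Types (f r s T C : {set V}) (A : {set {set V}}).

Lemma card_brick T : T \in bricks n K -> #|T| = n.+1.
Proof. by rewrite inE => /andP[_ /eqP]. Qed.

Lemma facet_sub_brick T f :
  T \in bricks n K -> f \subset T -> #|f| = n -> f \in facets n K.
Proof.
case: pK => -[_ closed] _ _ _ _; rewrite !inE => /andP[TK _] fT fn.
rewrite fn eqxx andbT; apply: closed fT _ => //.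
by rewrite -card_gt0 fn.
Qed.

Lemma exists_brick : exists T, T \in bricks n K.
Proof.
case: pK => _ dimK cov _ _.
case: (set_0Vmem K) => [K0|[s /cov[T TK _]]]; last by exists T.
by move: dimK; rewrite /has_dim K0 big_set0.
Qed.

Lemma other_brick C f : C \in bricks n K -> f \in facets n K ->
  exists T, [/\ T \in bricks n K, T != C & f \subset T].
Proof.
move=> CK fK; case: pK => _ _ _ /(_ f fK) + _.
set S := [set T in bricks n K | f \subset T] => two.
have /card_gt0P[T] : 0 < #|S :\ C|.
  by have := cardsD1 C S; rewrite two; case: #|S :\ C| => //; case: (C \in S).
by rewrite in_setD1 inE => /and3P[TC TK fT]; exists T.
Qed.

Lemma facet_of_brick C : C \in bricks n K ->
  exists2 f, f \in facets n K & f \subset C.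
Proof.
move=> CK; have Cn := card_brick CK.
have /card_gt0P[x xC] : 0 < #|C| by rewrite Cn.
exists (C :\ x); last exact: subsetDl.
apply: (facet_sub_brick CK (subsetDl _ _)).
by move: (cardsD1 x C); rewrite xC Cn => -[].
Qed.

Lemma exists_other_brick C : C \in bricks n K ->
  exists2 T, T \in bricks n K & T != C.
Proof.
move=> CK; have [f fK _] := facet_of_brick CK.
by have [T [TK TC _]] := other_brick CK fK; exists T.
Qed.

(** Strong connectedness: were the cut empty, A would be a union of components
of the dual graph. *)
Lemma cut_neq0 A S S' : S \in bricks n K -> S' \in bricks n K ->
  S \in A -> S' \notin A -> exists f, f \in cut n K A.
Proof.
move=> SK SK' SA SA'; case: (set_0Vmem (cut n K A)) => [E|[f fc]]; last by exists f.
case: pK => _ _ _ _ /(_ _ _ SK SK') conn.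
have cl : fingraph.closed (brick_adj n K) [pred T | T \in A].
  move=> T T' /and4P[TK TK' _ /exists_inP[f fK /andP[fT fT']]].
  rewrite !inE; apply/idP/idP=> H; apply: contraT => H'.
    suff : f \in cut n K A by rewrite E inE.
    by apply/cutP; split=> //; exists T, T'.
  suff : f \in cut n K A by rewrite E inE.
  by apply/cutP; split=> //; exists T', T.
by move: (closed_connect cl conn); rewrite !inE SA (negbTE SA').
Qed.

Lemma card_between r T : r \subset T -> #|r|.+1 = n -> #|T| = n.+1 ->
  #|[set f : {set V} | [&& r \subset f, f \subset T & #|f| == n]]| = 2.
Proof.
move=> rT rn Tn.
have -> : [set f : {set V} | [&& r \subset f, f \subset T & #|f| == n]]
        = [set x |: r | x in T :\: r].
  apply/setP=> f; rewrite inE; apply/and3P/imsetP.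
    case=> rf fT /eqP fn.
    have /eqP/cards1P[x xE] : #|f :\: r| = 1 by rewrite cardsDS // fn -rn subSnn.
    exists x; last by rewrite -xE setUC -[X in X :|: _](setIidPr rf) setID.
    have : x \in f :\: r by rewrite xE set11.
    by rewrite !inE => /andP[-> /(subsetP fT)].
  case=> x; rewrite inE => /andP[xr xT] ->.
  by rewrite subsetUr subUset sub1set xT rT cardsU1 xr -rn.
rewrite card_in_imset; first by rewrite cardsDS // Tn -rn -addn2 addnC addnK.
move=> x y; rewrite !inE => /andP[xr xT] /andP[yr yT] /setP/(_ x).
by rewrite !inE eqxx (negbTE xr) !orbF => /esym/eqP.
Qed.

(** The cut is the mod 2 boundary of the chain A, and a boundary is a cycle.
Concretely, count the pairs of a brick T of A and a facet f with r, f, T nested: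
each T counts two facets f ([card_between]), while f counts an odd number of
bricks exactly when it is cut. *)
Lemma cut_cycle A r : #|r|.+1 = n ->
  ~~ odd #|[set f in cut n K A | r \subset f]|.
Proof.
move=> rn; pose B := [set T in bricks n K | T \in A].
pose c f := #|[set T in B | f \subset T]|.
have double : \sum_(f in facets n K | r \subset f) c f
            = \sum_(T in B | r \subset T) 2.
  transitivity (\sum_(f in facets n K | r \subset f)
                  \sum_(T in B | f \subset T) 1).
    by apply: eq_bigr => f _; rewrite /c -sum1_card; apply: eq_bigl => T;
      rewrite inE.
  rewrite (exchange_big_dep (fun T => (T \in B) && (r \subset T))) /=; last first.
    by move=> f T /andP[_ rf] /andP[-> fT] /=; apply: subset_trans fT.
  apply: eq_bigr => T /andP[TB rT].
  have TK : T \in bricks n K by move: TB; rewrite inE => /andP[].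
  rewrite -(card_between rT rn (card_brick TK)) -sum1_card.
  apply: eq_bigl => f; rewrite [in RHS]inE TB /=.
  apply/andP/and3P => [[/andP[fK rf] fT]|[rf fT /eqP fn]].
    by split=> //; move: fK; rewrite inE => /andP[].
  by rewrite rf (facet_sub_brick TK fT fn).
have c01 f : f \in facets n K -> odd (c f) = (f \in cut n K A).
  move=> fK; case: pK => _ _ _ /(_ f fK) two _.
  move: (two); rewrite -(cardsID A).
  have -> : [set T in bricks n K | f \subset T] :&: A = [set T in B | f \subset T].
    by apply/setP=> T; rewrite !inE; case: (T \in A); rewrite ?andbF ?andbT.
  rewrite -/(c f); set d := #|_ :\: A| => cd.
  have -> : (f \in cut n K A) = (0 < c f) && (0 < d).
    apply/cutP/andP.
      case=> _ [T [T' [TK TK' TA TA' [fT fT']]]]; split; apply/card_gt0P.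
        by exists T; rewrite !inE TA fT; move: TK; rewrite inE => ->.
      by exists T'; rewrite !inE TA' fT'; move: TK'; rewrite inE => ->.
    case=> /card_gt0P[T TI] /card_gt0P[T' TI']; split=> //; exists T, T'.
    move: TI TI'; rewrite !(inE, in_setD) => /andP[/andP[-> ->] ->].
    by case/andP=> -> /andP[-> ->].
  by case: (c f) d cd => [|[|[|?]]] [|[|?]].
have -> : [set f in cut n K A | r \subset f]
        = [set f | (f \in facets n K) && (r \subset f) & odd (c f)].
  apply/setP=> f; rewrite [LHS]inE [RHS]inE.
  case fK: (f \in facets n K); first by rewrite -c01 // andbC.
  by apply/negbTE/negP=> /andP[/cutP[]]; rewrite fK.
by rewrite -odd_sum double sum_nat_const muln2 odd_double.
Qed.

(** A nonzero mod 2 cycle of dimension n-1 has at least as many facets as the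
boundary of an n-simplex: for each vertex v of a cut facet f0, the cycle
condition at [f0 :\ v] yields another cut facet, and since that facet meets f0
in exactly [f0 :\ v], different v yield different facets. *)
Lemma cut_ge A S S' : S \in bricks n K -> S' \in bricks n K ->
  S \in A -> S' \notin A -> n.+1 <= #|cut n K A|.
Proof.
move=> SK SK' SA SA'; have [f0 f0c] := cut_neq0 SK SK' SA SA'.
have f0n : #|f0| = n by case/cutP: f0c; rewrite inE => /andP[_ /eqP].
have other v : v \in f0 ->
    exists f, [&& f \in cut n K A, f0 :\ v \subset f & f != f0].
  move=> vf0; have rn : #|f0 :\ v|.+1 = n by rewrite -f0n (cardsD1 v f0) vf0.
  have := cut_cycle A rn; rewrite (cardsD1 f0) inE f0c subsetDl /=.
  rewrite negbK => /odd_gt0/card_gt0P[f].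
  by rewrite in_setD1 inE => /and3P[ff0 fc sf]; exists f; rewrite fc sf ff0.
pose g v := odflt f0 [pick f | [&& f \in cut n K A, f0 :\ v \subset f & f != f0]].
have gP v : v \in f0 -> [&& g v \in cut n K A, f0 :\ v \subset g v & g v != f0].
  move=> vf0; rewrite /g; case: pickP => [f //|none].
  by case: (other v vf0) => f; rewrite none.
have gn v : v \in f0 -> v \notin g v.
  move=> vf0; case/and3P: (gP v vf0) => /cutP[]; rewrite inE.
  case/andP=> _ /eqP gn _ sub; apply: contra => vg.
  rewrite eq_sym eqEcard f0n gn leqnn andbT.
  by rewrite -(setD1K vf0) subUset sub1set vg.
have ginj : {in f0 &, injective g}.
  move=> v w vf wf E; apply/eqP; apply: contraT => vw.
  case/and3P: (gP w wf) => _ /subsetP/(_ v) + _.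
  by rewrite !inE vw vf -E (negbTE (gn v vf)) => /(_ isT).
have : f0 |: g @: f0 \subset cut n K A.
  rewrite subUset sub1set f0c; apply/subsetP=> _ /imsetP[v vf ->].
  by case/and3P: (gP v vf).
move/subset_leq_card; apply: leq_trans; rewrite cardsU1 card_in_imset // f0n.
suff -> : f0 \notin g @: f0 by [].
apply/imsetP=> -[v vf E]; case/and3P: (gP v vf) => _ _.
by rewrite -E eqxx.
Qed.

End Pseudomanifold.

(** * Gluing along a brick *)

(** A connected sum up to the choice of the ambient vertex set W.  The type
[V1 + V2] of the concrete construction favours the second summand; here both
summands are embedded by injections and play the same role, so that each lemma
can be used on either side. *)
Definition glued (n : nat) (V1 V2 W : finType)
    (M1 : {set {set V1}}) (C1 : {set V1}) (i1 : V1 -> W)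
    (M2 : {set {set V2}}) (C2 : {set V2}) (i2 : V2 -> W)
    (K : {set {set W}}) : Prop :=
  [/\ [/\ injective i1, injective i2 & i1 @: C1 = i2 @: C2],
      forall x y, i1 x = i2 y -> x \in C1,
      C1 \in bricks n M1, C2 \in bricks n M2 &
      K = [set i1 @: s | s : {set V1} in M1 :\ C1]
          :|: [set i2 @: s | s : {set V2} in M2 :\ C2]].

Lemma gluedC n (V1 V2 W : finType) M1 C1 (i1 : V1 -> W) M2 C2 (i2 : V2 -> W) K :
  glued n M1 C1 i1 M2 C2 i2 K -> glued n M2 C2 i2 M1 C1 i1 K.
Proof.
case=> -[inj1 inj2 eqC] ov CM1 CM2 ->; split=> //; last exact: setUC.
move=> y x E; rewrite -(mem_imset C2 y inj2) -eqC E mem_imset //.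
exact: (ov x y).
Qed.

Lemma sub_imsetE (V W : finType) (i : V -> W) (s : {set W}) (T : {set V}) :
  s \subset i @: T -> i @: (i @^-1: s) = s.
Proof.
move=> sT; apply/setP=> w; apply/imsetP/idP => [[v + ->]|ws].
  by rewrite inE.
by have /imsetP[v _ E] := subsetP sT w ws; exists v; rewrite ?inE -?E.
Qed.

Lemma preimsetK (V W : finType) (i : V -> W) (T : {set V}) :
  injective i -> i @^-1: (i @: T) = T.
Proof. by move=> inj; apply/setP=> v; rewrite inE mem_imset. Qed.

Lemma imset_sub (V W : finType) (i : V -> W) (S T : {set V}) :
  injective i -> (i @: S \subset i @: T) = (S \subset T).
Proof.
move=> inj; apply/idP/idP; last exact: imsetS.
by move/(preimsetS i); rewrite !preimsetK.
Qed.

Section Glued.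

Variables (n : nat) (V1 V2 W : finType).
Variables (M1 : {set {set V1}}) (C1 : {set V1}) (i1 : V1 -> W).
Variables (M2 : {set {set V2}}) (C2 : {set V2}) (i2 : V2 -> W).
Variable K : {set {set W}}.
Hypotheses (n_gt0 : 0 < n) (gK : glued n M1 C1 i1 M2 C2 i2 K).

Lemma glued_overlap (f : {set V1}) (T : {set V2}) :
  i1 @: f \subset i2 @: T -> f \subset C1.
Proof.
case: gK => _ ov _ _ _ sub; apply/subsetP=> x xf.
by have /imsetP[y _ /ov] := subsetP sub _ (imset_f i1 xf).
Qed.

Lemma glued_brick T : T \in bricks n M1 -> T != C1 -> i1 @: T \in bricks n K.
Proof.
case: gK => -[inj1 _ _] _ _ _ ->; rewrite !inE => /andP[TM Tn] TC.
rewrite card_imset // Tn andbT; apply/orP; left.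
by apply: imset_f; rewrite !inE TC.
Qed.

Lemma glued_facet f : f \in facets n M1 -> i1 @: f \in facets n K.
Proof.
case: gK => -[inj1 _ _] _ CM _ ->; rewrite !inE => /andP[fM fn].
rewrite card_imset // fn andbT; apply/orP; left.
apply: imset_f; rewrite !inE fM andbT; apply/eqP=> E.
by move: fn; rewrite E (card_brick CM) -[X in _ == X]addn0 -addn1 eqn_add2l.
Qed.

Lemma glued_brickP Q : Q \in bricks n K ->
  (exists T, [/\ T \in bricks n M1, T != C1 & Q = i1 @: T]) \/
  (exists T, [/\ T \in bricks n M2, T != C2 & Q = i2 @: T]).
Proof.
case: gK => -[inj1 inj2 _] _ _ _ ->; rewrite !inE => /andP[/orP[] /imsetP[T]].
  rewrite !inE => /andP[TC TM] ->; rewrite card_imset // => Tn.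
  by left; exists T; rewrite inE TM Tn.
rewrite !inE => /andP[TC TM] ->; rewrite card_imset // => Tn.
by right; exists T; rewrite inE TM Tn.
Qed.

(** A brick of M1 lying on the second side would lie in the overlap C1. *)
Lemma glued_brick_neq T (T' : {set V2}) :
  T \in bricks n M1 -> T != C1 -> i1 @: T <> i2 @: T'.
Proof.
case: gK => _ _ CM _ _ TM /eqP TC E; apply: TC; apply/eqP.
rewrite eqEcard (card_brick TM) (card_brick CM) leqnn andbT.
by apply: (@glued_overlap _ T'); rewrite E.
Qed.

Lemma glued_sub_facet g T : pseudomanifold n M1 -> T \in bricks n M1 ->
  g \in facets n K -> g \subset i1 @: T ->
  exists f, [/\ f \in facets n M1, f \subset T & g = i1 @: f].
Proof.
case: gK => -[inj1 _ _] _ _ _ _ pM1 TM; rewrite inE => /andP[_ /eqP gn] gT.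
have gE := sub_imsetE gT; exists (i1 @^-1: g).
have fT : i1 @^-1: g \subset T by rewrite -(imset_sub _ _ inj1) gE.
split=> //; apply: (facet_sub_brick n_gt0 pM1 TM fT).
by rewrite -(card_imset _ inj1) gE.
Qed.

End Glued.

(** * Comparing cuts of the sum and of a summand *)

Section GluedCut.

Variables (n : nat) (V1 V2 W : finType).
Variables (M1 : {set {set V1}}) (C1 : {set V1}) (i1 : V1 -> W).
Variables (M2 : {set {set V2}}) (C2 : {set V2}) (i2 : V2 -> W).
Variable K : {set {set W}}.
Hypotheses (n_gt0 : 0 < n) (gK : glued n M1 C1 i1 M2 C2 i2 K).
Hypotheses (pM1 : pseudomanifold n M1) (pM2 : pseudomanifold n M2).

Let gKC := gluedC gK.

(** When all bricks of M2 lie outside P, the whole second side behaves like the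
single brick C1 outside A. *)
Lemma cut_glued_one_side (P : {set {set W}}) (A : {set {set V1}}) :
  C1 \notin A ->
  {in bricks n M1, forall T, T != C1 -> (i1 @: T \in P) = (T \in A)} ->
  {in bricks n M2, forall T, T != C2 -> i2 @: T \notin P} ->
  cut n K P = [set i1 @: f | f : {set V1} in cut n M1 A].
Proof.
move=> CA eqA P2; case: (gK) => -[inj1 inj2 eqC] _ CM1 CM2 _.
apply/setP=> g; apply/cutP/imsetP.
  case=> gK' [Q [Q' [QK Q'K QP Q'P [gQ gQ']]]].
  have [[T [TM TC QE]]|[T [TM TC QE]]] := glued_brickP gK QK; last first.
    by move: QP; rewrite QE (negbTE (P2 T TM TC)).
  have [f [fM fT gE]] : exists f, [/\ f \in facets n M1, f \subset T & g = i1 @: f].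
    by apply: (glued_sub_facet n_gt0 gK pM1 TM) => //; rewrite -QE.
  exists f => //; apply/cutP; split=> //; have TA : T \in A by rewrite -eqA // -QE.
  have [[T' [TM' TC' QE']]|[T' [TM' TC' QE']]] := glued_brickP gK Q'K.
    exists T, T'; split=> //; first by rewrite -eqA // -QE'.
    by split=> //; rewrite -(imset_sub _ _ inj1) -gE -QE'.
  exists T, C1; split=> //; split=> //.
  by apply: (glued_overlap gK (T := T')); rewrite -gE -QE'.
case=> f /cutP[fM [T [T' [TM TM' TA TA' [fT fT']]]]] ->; split.
  exact: (glued_facet gK).
have TC : T != C1 by apply: contraNneq CA => <-.
exists (i1 @: T); have [E|TC'] := eqVneq T' C1; last first.
  exists (i1 @: T'); split; rewrite ?(glued_brick gK) ?eqA //.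
  by rewrite !imset_sub.
(* The facet lies on the glued sphere: its second brick comes from the other
   side. *)
have sub : i1 @: f \subset i2 @: C2 by rewrite -eqC imset_sub // -E.
have fE := sub_imsetE sub.
have f2C : i2 @^-1: (i1 @: f) \subset C2 by rewrite -(imset_sub _ _ inj2) fE.
have f2M : i2 @^-1: (i1 @: f) \in facets n M2.
  apply: (facet_sub_brick n_gt0 pM2 CM2 f2C).
  rewrite -(card_imset _ inj2) fE card_imset //.
  by move: fM; rewrite inE => /andP[_ /eqP].
have [S [SM SC fS]] := other_brick pM2 CM2 f2M.
exists (i2 @: S); split; rewrite ?(glued_brick gK) ?(glued_brick gKC) ?eqA ?P2 //.
by rewrite imset_sub // -{1}fE imset_sub.
Qed.

(** Here C1 counts as a brick of A although P may miss bricks of the second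
side.  The facets of C1 that A cuts in M1 are those whose other brick is outside
P (X0 below); such a facet is still cut in the sum when its second-side brick is
in P (Y1 below), and the others are paid for by the facets D2 cut inside the
second side, since [cut_ge] bounds [#|D2| + #|Y1|] below by n+1. *)
Lemma cut_glued_both_sides (P : {set {set W}}) (A : {set {set V1}}) S :
  C1 \in A ->
  {in bricks n M1, forall T, T != C1 -> (i1 @: T \in P) = (T \in A)} ->
  S \in bricks n M2 -> S != C2 -> i2 @: S \in P ->
  #|cut n M1 A| <= #|cut n K P|.
Proof.
move=> CA eqA SM SC SP; case: (gK) => -[inj1 inj2 eqC] _ CM1 CM2 _.
pose B := [set T | (T != C2) && (i2 @: T \in P)].
have cutB : n.+1 <= #|cut n M2 B|.
  by apply: (cut_ge n_gt0 pM2 SM CM2); rewrite !inE ?SC ?eqxx.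
(* D1 and D2 are cut off the gluing sphere, [X0 :&: Y1] on it. *)
pose in1 := [set f : {set V1} | f \subset C1].
pose in2 := [set f : {set V2} | f \subset C2].
pose X0 := [set i1 @: f | f : {set V1} in cut n M1 A :&: in1].
pose Y1 := [set i2 @: f | f : {set V2} in cut n M2 B :&: in2].
pose D1 := [set i1 @: f | f : {set V1} in cut n M1 A :\: in1].
pose D2 := [set i2 @: f | f : {set V2} in cut n M2 B :\: in2].
have cX0 : #|X0| = #|cut n M1 A :&: in1| by apply: card_imset; apply: imset_inj.
have cY1 : #|Y1| = #|cut n M2 B :&: in2| by apply: card_imset; apply: imset_inj.
have cD1 : #|D1| = #|cut n M1 A :\: in1| by apply: card_imset; apply: imset_inj.
have cD2 : #|D2| = #|cut n M2 B :\: in2| by apply: card_imset; apply: imset_inj.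
have XY : #|X0 :|: Y1| <= n.+1.
  have <- : #|[set g : {set W} | g \subset i1 @: C1 & #|g| == n]| = n.+1.
    by rewrite cards_draws card_imset // (card_brick CM1) binSn.
  apply/subset_leq_card/subsetP=> g /setUP[] /imsetP[f].
    rewrite in_setI => /andP[/cutP[+ _]]; rewrite !inE => /andP[_ fn] fC ->.
    by rewrite imset_sub // fC card_imset.
  rewrite in_setI => /andP[/cutP[+ _]]; rewrite !inE => /andP[_ fn] fC ->.
  by rewrite eqC imset_sub // fC card_imset.
have sub1 : D1 \subset cut n K P.
  apply/subsetP=> _ /imsetP[f + ->]; rewrite in_setD inE => /andP[fC].
  case/cutP=> fM [T [T' [TM TM' TA TA' [fT fT']]]]; apply/cutP.
  have TC : T != C1 by apply: contraNneq fC => <-.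
  have TC' : T' != C1 by apply: contraNneq fC => <-.
  split; first exact: (glued_facet gK).
  exists (i1 @: T), (i1 @: T'); rewrite !(glued_brick gK) ?eqA //.
  by rewrite !imset_sub.
have sub2 : D2 \subset cut n K P.
  apply/subsetP=> _ /imsetP[f + ->]; rewrite in_setD inE => /andP[fC].
  case/cutP=> fM [T [T' [TM TM' TB TB' [fT fT']]]]; apply/cutP.
  have TC : T != C2 by apply: contraNneq fC => <-.
  have TC' : T' != C2 by apply: contraNneq fC => <-.
  split; first exact: (glued_facet gKC).
  exists (i2 @: T), (i2 @: T'); rewrite !(glued_brick gKC) //.
  by move: TB TB'; rewrite !inE TC TC' !imset_sub.
have subXY : X0 :&: Y1 \subset cut n K P.
  apply/subsetP=> g; rewrite inE => /andP[/imsetP[f + gE] /imsetP[f' + gE']].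
  rewrite !in_setI => /andP[/cutP[fM [T [T' [TM TM' TA TA' [fT fT']]]]] _].
  case/andP=> /cutP[f2M [U [U' [UM UM' UB UB' [fU fU']]]]] _; apply/cutP.
  move: UB; rewrite inE => /andP[UC UP].
  have TC' : T' != C1 by apply: contraNneq TA' => ->.
  split; first by rewrite gE; apply: (glued_facet gK).
  exists (i2 @: U), (i1 @: T'); rewrite (glued_brick gK) // (glued_brick gKC) //.
  by rewrite eqA // {1}gE' gE !imset_sub.
have dis12 : [disjoint D1 & D2].
  rewrite -setI_eq0 -subset0; apply/subsetP=> g.
  rewrite inE => /andP[/imsetP[f + gE] /imsetP[f' + gE']].
  rewrite in_setD inE => /andP[/negP fC] _ _; case: fC.
  by apply: (glued_overlap gK (T := f')); rewrite -gE gE'.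
have dis3 : [disjoint D1 :|: D2 & X0 :&: Y1].
  rewrite -setI_eq0 -subset0; apply/subsetP=> g.
  rewrite inE => /andP[/setUP[] /imsetP[f]].
    rewrite in_setD inE => /andP[/negP fC _] ->.
    case/setIP=> /imsetP[f' + /(imset_inj inj1) E] _.
    by rewrite -E !inE => /andP[_ /fC].
  rewrite in_setD inE => /andP[/negP fC _] ->.
  case/setIP=> _ /imsetP[f' + /(imset_inj inj2) E].
  by rewrite -E !inE => /andP[_ /fC].
have tot : #|D1| + #|D2| + #|X0 :&: Y1| <= #|cut n K P|.
  move: dis12 dis3; rewrite -!leq_card_setU => /eqP <- /eqP <-.
  by apply: subset_leq_card; rewrite !subUset sub1 sub2.
have := cardsUI X0 Y1.
move: tot XY cutB; rewrite -(cardsID in1 (cut n M1 A)) -(cardsID in2 (cut n M2 B)).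
rewrite -cX0 -cY1 -cD1 -cD2.
move: #|D1| #|D2| #|X0| #|Y1| #|X0 :&: Y1| #|X0 :|: Y1| #|cut n K P|; clear; lia.
Qed.

End GluedCut.

(** * The trunk of a glued complex *)

Section GluedTrunk.

Variables (n : nat) (V1 V2 W : finType).
Variables (M1 : {set {set V1}}) (C1 : {set V1}) (i1 : V1 -> W).
Variables (M2 : {set {set V2}}) (C2 : {set V2}) (i2 : V2 -> W).
Variable K : {set {set W}}.
Hypotheses (n_gt0 : 0 < n) (gK : glued n M1 C1 i1 M2 C2 i2 K).
Hypotheses (pM1 : pseudomanifold n M1) (pM2 : pseudomanifold n M2).

Let gKC := gluedC gK.

(** The lower bound holds for every choice of bricks and gluing map. *)
Lemma trunk_glued_ge : trunk n M1 <= trunk n K.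
Proof.
case: (gK) => -[inj1 inj2 _] _ CM1 CM2 _.
have /trunk_leP[h [hinj hk]] := leqnn (trunk n K).
have [S0 S0M S0C] := exists_other_brick n_gt0 pM2 CM2.
have S0P : [pred S | (S \in bricks n M2) && (S != C2)] S0 by rewrite /= S0M.
case: (arg_minnP (fun T : {set V2} => h (i2 @: T)) S0P) => S /= /andP[SM SC] Smin.
(* C1 takes the place of S, the lowest brick of the second side. *)
pose h1 T := if T == C1 then h (i2 @: S) else h (i1 @: T).
apply/trunk_leP; exists h1; split.
  move=> T T' TM TM'; rewrite /h1.
  have [->|TC] := eqVneq T C1; have [->|TC'] := eqVneq T' C1 => //.
  - move/hinj => /(_ (glued_brick gKC SM SC) (glued_brick gK TM' TC')) /esym E.
    by case: (glued_brick_neq gK TM' TC' E).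
  - move/hinj => /(_ (glued_brick gK TM TC) (glued_brick gKC SM SC)) E.
    by case: (glued_brick_neq gK TM TC E).
  by move/hinj => /(_ (glued_brick gK TM TC) (glued_brick gK TM' TC'))
     /(imset_inj inj1).
move=> t; apply: leq_trans (hk t).
have eqA : {in bricks n M1, forall T, T != C1 ->
    (i1 @: T \in [set Q | h Q < t]) = (T \in [set T | h1 T < t])}.
  by move=> T _ TC; rewrite !inE /h1 (negbTE TC).
have [ltS|leS] := ltnP (h (i2 @: S)) t.
  apply: (cut_glued_both_sides n_gt0 gK pM2 _ eqA SM SC); rewrite inE //.
  by rewrite /h1 eqxx.
rewrite (cut_glued_one_side n_gt0 gK pM1 pM2 _ eqA).
- by rewrite card_imset //; apply: imset_inj.
- by rewrite inE /h1 eqxx -leqNgt.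
move=> T TM TC; rewrite inE -leqNgt; apply: leq_trans leS _.
by apply: Smin; rewrite TM.
Qed.

(** With C1 the last brick of its side and C2 the first of the other, every cut
produced by the concatenated heights is one to which [cut_glued_one_side]
applies, on one side or the other. *)
Lemma trunk_glued_le (h1 : {set V1} -> nat) (h2 : {set V2} -> nat) k :
  {in bricks n M1 &, injective h1} -> {in bricks n M2 &, injective h2} ->
  (forall t, #|cut n M1 [set T | h1 T < t]| <= k) ->
  (forall t, #|cut n M2 [set T | h2 T < t]| <= k) ->
  {in bricks n M1, forall T, h1 T <= h1 C1} ->
  {in bricks n M2, forall T, h2 C2 <= h2 T} ->
  trunk n K <= k.
Proof.
move=> inj_h1 inj_h2 k1 k2 max1 min2.
case: (gK) => -[inj1 inj2 _] _ CM1 CM2 _.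
have lt1 T : T \in bricks n M1 -> T != C1 -> h1 T < h1 C1.
  move=> TM; apply: contraNltn => le; apply/eqP/inj_h1 => //.
  by apply/eqP; rewrite eqn_leq le max1.
have lt2 T : T \in bricks n M2 -> T != C2 -> h2 C2 < h2 T.
  move=> TM; apply: contraNltn => le; apply/eqP/inj_h2 => //.
  by apply/eqP; rewrite eqn_leq le min2.
pose h Q := if [exists T in bricks n M1, (T != C1) && (Q == i1 @: T)]
  then h1 (i1 @^-1: Q) else h1 C1 + h2 (i2 @^-1: Q).
have hE1 T : T \in bricks n M1 -> T != C1 -> h (i1 @: T) = h1 T.
  move=> TM TC; rewrite /h preimsetK //.
  case: exists_inP => // -[]; by exists T; rewrite // TC eqxx.
have hE2 T : T \in bricks n M2 -> h (i2 @: T) = h1 C1 + h2 T.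
  move=> TM; rewrite /h preimsetK //.
  case: exists_inP => // -[T' TM' /andP[TC' /eqP E]].
  by case: (glued_brick_neq gK TM' TC' (esym E)).
apply/trunk_leP; exists h; split.
  move=> Q Q' QK QK'.
  have [[T [TM TC ->]]|[T [TM TC ->]]] := glued_brickP gK QK;
  have [[T' [TM' TC' ->]]|[T' [TM' TC' ->]]] := glued_brickP gK QK'.
  - by rewrite !hE1 // => /inj_h1 ->.
  - by rewrite hE1 // hE2 //; move: (lt1 T TM TC); lia.
  - by rewrite hE1 // hE2 //; move: (lt1 T' TM' TC'); lia.
  - by rewrite !hE2 // => /addnI/inj_h2 ->.
move=> t; have [le|lt] := leqP t (h1 C1).
  rewrite (cut_glued_one_side (A := [set T | h1 T < t]) n_gt0 gK pM1 pM2).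
  - by rewrite card_imset; [exact: k1|exact: imset_inj].
  - by rewrite inE -leqNgt.
  - by move=> T TM TC; rewrite !inE hE1.
  by move=> T TM TC; rewrite inE hE2 // -leqNgt (leq_trans le) ?leq_addr.
(* All bricks of the first side are now below t, so the complementary cut is
   one-sided.  It must leave out C2, hence the maximum: a threshold not above
   [h2 C2] selects no other brick of M2. *)
pose t2 := maxn (t - h1 C1) (h2 C2).+1.
rewrite -cutC (cut_glued_one_side (A := ~: [set T | h2 T < t2]) n_gt0 gKC pM2 pM1).
- by rewrite cutC card_imset; [exact: k2|exact: imset_inj].
- by rewrite !inE negbK /t2 leq_maxr.
- by move=> T TM TC; rewrite !inE hE2 // /t2; move: (lt2 T TM TC) lt; lia.
by move=> T TM TC; rewrite !inE hE1 // negbK (ltn_trans (lt1 T TM TC)).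
Qed.

End GluedTrunk.

(** * Connected sums *)

Lemma exists_bij_on (V1 V2 : finType) (C1 : {set V1}) (C2 : {set V2}) :
  #|C1| = #|C2| -> C2 != set0 ->
  exists2 phi : V1 -> V2, {in C1 &, injective phi} & phi @: C1 = C2.
Proof.
move=> eqC /set0Pn[y0 _].
pose phi x := nth y0 (enum C2) (index x (enum C1)).
have lt x : x \in C1 -> index x (enum C1) < size (enum C2).
  by move=> xC; rewrite -cardE -eqC cardE index_mem mem_enum.
have inj : {in C1 &, injective phi}.
  move=> x x' xC xC' /eqP; rewrite nth_uniq ?enum_uniq ?lt // => /eqP.
  by move/(index_inj x); apply; rewrite mem_enum.
exists phi => //; apply/eqP; rewrite eqEcard card_in_imset // eqC leqnn andbT.
by apply/subsetP=> _ /imsetP[x xC ->]; rewrite -mem_enum mem_nth ?lt.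
Qed.

Lemma boundary_iso (V1 V2 : finType) (C1 : {set V1}) (C2 : {set V2})
    (phi : V1 -> V2) :
  {in C1 &, injective phi} -> phi @: C1 = C2 ->
  simplicial_iso (boundary C1) (boundary C2) phi.
Proof.
move=> inj im; split.
  suff sub x : x \in cover (boundary C1) -> x \in C1.
    by move=> x y /sub xC /sub yC; apply: inj.
  by case/bigcupP=> s; rewrite inE => /andP[_ /proper_sub/subsetP sC] /sC.
apply/setP=> s; apply/imsetP/idP.
  case=> r; rewrite !inE => /andP[r0 rC] ->.
  rewrite imset_eq0 r0 /= properEcard -im imsetS ?proper_sub //=.
  rewrite !card_in_imset //; first exact: proper_card.
  by move=> x y /(subsetP (proper_sub rC)) xC /(subsetP (proper_sub rC)); apply: inj.
rewrite inE => /andP[s0 sC]; pose r := [set x in C1 | phi x \in s].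
have E : s = phi @: r.
  apply/setP=> y; apply/idP/imsetP=> [ys|[x + ->]]; last by rewrite inE => /andP[].
  have := subsetP (proper_sub sC) y ys; rewrite -im => /imsetP[x xC yE].
  by exists x; rewrite // inE xC -yE.
exists r => //; rewrite inE -(imset_eq0 phi) -E s0 properE /=.
apply/andP; split; first by apply/subsetP=> x; rewrite inE => /andP[].
apply/negP=> /(imsetS phi); rewrite -E im => Cs.
by move: sC; rewrite properE Cs andbF.
Qed.

Lemma connected_sum_glued n (V1 V2 : finType) (M1 : {set {set V1}})
    (M2 : {set {set V2}}) C1 C2 (phi : V1 -> V2) :
  C1 \in bricks n M1 -> C2 \in bricks n M2 ->
  {in C1 &, injective phi} -> phi @: C1 = C2 ->
  glued n M1 C1 (glue1 C1 phi) M2 C2 inr (connected_sum M1 M2 C1 C2 phi).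
Proof.
move=> CM1 CM2 inj im; split=> //; last first.
  by move=> x y; rewrite /glue1; case: ifP.
split.
- move=> x y; rewrite /glue1; case: ifP => xC; case: ifP => yC // [].
    exact: inj.
  by [].
- by move=> x y [].
rewrite -im -imset_comp; apply: eq_in_imset => x xC.
by rewrite /glue1 xC.
Qed.

Theorem corollary5p4 (n : nat) (V1 V2 : finType)
    (M1 : {set {set V1}}) (M2 : {set {set V2}})
    (n_ge2 : 2 <= n) (n_even : ~~ odd n)
    (pM1 : pseudomanifold n M1) (pM2 : pseudomanifold n M2) :
  exists (C1 : {set V1}) (C2 : {set V2}) (phi : V1 -> V2),
    gluing n M1 M2 C1 C2 phi /\
    trunk n (connected_sum M1 M2 C1 C2 phi) = maxn (trunk n M1) (trunk n M2).
Proof.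
have n_gt0 : 0 < n by apply: ltn_trans n_ge2.
have /trunk_leP[h1 [inj1 k1]] := leqnn (trunk n M1).
have /trunk_leP[h2 [inj2 k2]] := leqnn (trunk n M2).
have [T1 T1M] := exists_brick pM1; have [T2 T2M] := exists_brick pM2.
case: (arg_maxnP h1 T1M) => C1 CM1 max1.
case: (arg_minnP h2 T2M) => C2 CM2 min2.
have eqC : #|C1| = #|C2| by rewrite (card_brick CM1) (card_brick CM2).
have C2_neq0 : C2 != set0 by rewrite -card_gt0 (card_brick CM2).
have [phi inj im] := exists_bij_on eqC C2_neq0.
exists C1, C2, phi; split.
  by split=> //; apply: boundary_iso.
have gK := connected_sum_glued CM1 CM2 inj im.
apply/eqP; rewrite eqn_leq geq_max; apply/and3P; split.
- apply: (trunk_glued_le n_gt0 gK pM1 pM2 inj1 inj2) => // t.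
    by rewrite leq_max k1.
  by rewrite leq_max k2 orbT.
- exact: (trunk_glued_ge n_gt0 gK pM1 pM2).
exact: (trunk_glued_ge n_gt0 (gluedC gK) pM2 pM1).
Qed.
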